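(* Let $K$ be a $(d-1)$-dimensional cubical complex and $\mathrm{sd}_c(K)$ its cubical barycentric subdivision. Then for $i=0,\ldots,d$, \[ h^{(c)}_i(\mathrm{sd}_c(K)) = \sum_{j=0}^{d} C(d,i,j)\, h^{(c)}_j(K), \] where the coefficients $C(d,i,j)$ are nonnegative rational numbers determined by the generating function \[ \sum_{j=0}^d\sum_{i=0}^d C(d,i,j)x^iy^j = \frac{1}{1+x}(1+x^{d+1}y^d) + \frac{xy}{2^{d-3}}\,\frac{(x+3)^{d-1}-(3x+1)^{d-1}y^{d-1}}{x+3-(3x+1)y} + \frac{x}{2^{d-1}(1+x)}\big((x+3)^{d-1}+(3x+1)^{d-1}y^d\big). \]
   Context: A cubical complex is a finite collection $K$ of polytopes in $\mathbb{R}^n$, each combinatorially isomorphic to a cube $[0,1]^m$, closed under taking faces and such that any two intersect in a common face; $f_j(K)$ is its number of $j$-dimensional faces. For a $(d-1)$-dimensional cubical complex $K$, the short cubical $h$-vector is defined by $\sum_{i=0}^{d-1} h^{(sc)}_i(K)x^i = \sum_{j=0}^{d-1} f_j(K)(2x)^j(1-x)^{d-1-j}$, and the (long) cubical $h$-vector $(h^{(c)}_0(K),\ldots,h^{(c)}_d(K))$ is defined by $h^{(c)}_0(K)=2^{d-1}$ and $h^{(sc)}_i(K)=h^{(c)}_i(K)+h^{(c)}_{i+1}(K)$ for $0\le i\le d-1$. The cubical barycentric subdivision $\mathrm{sd}_c(K)$ is the cubical complex whose vertices are the barycenters of the nonempty faces of $K$ and whose nonempty faces are, for each closed interval $[F,G]$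 in the poset of nonempty faces of $K$ ordered by inclusion, the convex hull of the barycenters of the faces in $[F,G]$; it has the same dimension as $K$. *)

(* Defs.v *)
From HB Require Import structures.
From mathcomp Require Import all_boot all_order all_algebra.
From mathcomp Require Import finmap.
From mathcomp Require Import boolp classical_sets functions cardinality fsbigop.
From mathcomp Require Import reals convex.

Set Implicit Arguments.
Unset Strict Implicit.
Unset Printing Implicit Defensive.

Import Order.TTheory GRing.Theory Num.Theory.

Local Open Scope classical_set_scope.
Local Open Scope ring_scope.

Section Polytopes.
Context {R : realType}.

Definition hull n (A : set 'rV[R]_n) : set 'rV[R]_n :=
  smallest (@convex_set R _) A.

Definition polytope n (P : set 'rV[R]_n) : Prop :=
  exists2 A : set 'rV[R]_n, finite_set A & P = hull A.

(* The valid inequalities [0 <= 1] and [0 <= 0] make [set0] and [P] itself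
   faces of [P]. *)
Definition face n (P F : set 'rV[R]_n) : Prop :=
  exists (u : {scalar 'rV[R]_n}) (c : R),
    (forall x, P x -> u x <= c) /\ F = P `&` [set x | u x = c].

Definition inclusion_iso (T U : Type) (A : set (set T)) (B : set (set U)) :
    Prop :=
  exists phi : set T -> set U,
    set_bij A B phi /\
    (forall F G, A F -> A G -> (phi F `<=` phi G <-> F `<=` G)).

Definition combinatorially_isomorphic m n
    (P : set 'rV[R]_m) (Q : set 'rV[R]_n) : Prop :=
  inclusion_iso (face P) (face Q).

Definition cube m : set 'rV[R]_m := [set x | forall i, 0 <= x 0 i <= 1].

Definition vertices n (P : set 'rV[R]_n) : set 'rV[R]_n :=
  [set v | face P [set v]].

Definition barycenter n (P : set 'rV[R]_n) : 'rV[R]_n :=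
  (#|` fset_set (vertices P)|%:R)^-1 *: \sum_(v \in vertices P) v.

End Polytopes.

Section CubicalComplexes.
Context {R : realType} {n : nat}.
Implicit Types K : set (set 'rV[R]_n).

(* A nonempty complex contains the empty face, which is the only member that
   is not a cube. *)
Definition cubical_complex K : Prop :=
  [/\ finite_set K,
      forall P, K P -> polytope P /\
        (P !=set0 -> exists m, combinatorially_isomorphic P (@cube R m)),
      forall P F, K P -> face P F -> K F
    & forall P Q, K P -> K Q -> face P (P `&` Q) /\ face Q (P `&` Q)].

(* [F] is a [j]-dimensional face of [K]: a nonempty member whose subfaces in
   [K] are arranged as the faces of [0,1]^j.  When [K] is a cubical complex, the
   members of [K] contained in [F] are exactly the faces of the polytope [F],
   so this says that [F] is combinatorially isomorphic to [0,1]^j.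
   Reading the faces off [K] matters for subdivisions: the barycenters of the
   faces in an interval [[F, G]] need not span an affine space of dimension
   [dim G - dim F] when [G] is only combinatorially a cube (for a generic
   3-dimensional [G] and an edge [F] these four points are not coplanar), yet
   the interval is a cube of dimension [dim G - dim F] of the subdivision. *)
Definition dim_face K (j : nat) (F : set 'rV[R]_n) : Prop :=
  [/\ K F, F !=set0
    & inclusion_iso [set G | K G /\ G `<=` F] (face (@cube R j))].

Lemma dim_faceE K j F : cubical_complex K ->
  dim_face K j F <->
  [/\ K F, F !=set0 & combinatorially_isomorphic F (@cube R j)].
Proof.
move=> [_ _ Kface KI].
suff sub : K F -> [set G | K G /\ G `<=` F] = face F.
  by split=> -[KF F0]; have := sub KF; rewrite /combinatorially_isomorphic
    => e iso; split=> //; [rewrite -e|rewrite e].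
move=> KF; apply/seteqP; split=> [G [KG GF]|G FG].
  by have [+ _] := KI _ _ KF KG; rewrite setIidr.
by split; [exact: Kface FG|case: FG => u [c [_ ->]] x []].
Qed.

Definition has_dim K (k : nat) : Prop :=
  (exists F, dim_face K k F) /\ (forall j F, dim_face K j F -> (j <= k)%N).

Definition fvec K (j : nat) : nat := #|` fset_set (dim_face K j)|.

Definition sdc K : set (set 'rV[R]_n) :=
  [set Q | Q = set0 \/
    exists F G, [/\ K F, K G, F !=set0, F `<=` G
      & Q = hull (@barycenter R n @` [set H | [/\ K H, F `<=` H & H `<=` G]])]].

(* For [K] of dimension [d - 1]. *)
Definition hsc_poly (d : nat) K : {poly rat} :=
  \sum_(j < d) (fvec K j)%:R *: ((2 *: 'X) ^+ j * (1 - 'X) ^+ (d.-1 - j)).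

Definition hsc (d : nat) K (i : nat) : rat := (hsc_poly d K)`_i.

Fixpoint hc (d : nat) K (i : nat) : rat :=
  if i is i'.+1 then hsc d K i' - hc d K i' else 2 ^+ d.-1.

End CubicalComplexes.

(* Q(x, y), as the fraction field of Q[x][y] *)
Definition ratfun2 := {fraction {poly {poly rat}}}.
Definition ratc (c : rat) : ratfun2 := FracField.tofrac (c%:P)%:P.
Definition xvar : ratfun2 := FracField.tofrac ('X)%:P.
Definition yvar : ratfun2 := FracField.tofrac 'X.

Definition genfun (d : nat) : ratfun2 :=
  let x := xvar in let y := yvar in
  1 / (1 + x) * (1 + x ^+ d.+1 * y ^+ d)
  + x * y / 2 ^ (d%:Z - 3)
    * (((x + 3) ^+ d.-1 - (3 * x + 1) ^+ d.-1 * y ^+ d.-1)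
       / (x + 3 - (3 * x + 1) * y))
  + x / (2 ^+ d.-1 * (1 + x))
    * ((x + 3) ^+ d.-1 + (3 * x + 1) ^+ d.-1 * y ^+ d).

(* [C i j] stands for C(d,i,j) *)
Definition has_genfun (d : nat) (C : 'M[rat]_d.+1) : Prop :=
  \sum_(j < d.+1) \sum_(i < d.+1) ratc (C i j) * xvar ^+ i * yvar ^+ j
  = genfun d.

(* Main.v *)
(** Put [a = (x + 3) / 2] and [b = (3 x + 1) / 2].  The cube of [sd_c K] attached
    to an interval [[F, G]] has dimension [dim G - dim F], and a [k]-cube has
    [2^j C(k, j)] faces of codimension [j]; summing over [F] turns each summand
    [(2 x)^k (1 - x)^(d-1-k)] of the short h-polynomial of [K] into
    [(3 x + 1)^k (1 - x)^(d-1-k)].  Since [2 b = 3 x + 1] and [a - b = 1 - x], this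
    is the substitution [x := b / a] in the degree [d - 1] homogenization, and the
    relation [(1 + x) h(x) = h_0 + x h_sc(x) + h_d x^(d+1)] transfers it to the
    long h-vector.

    Distinct intervals give distinct cubes, with inclusion of cubes equivalent to
    inclusion of intervals, because the barycenter of a face [H] lies in a member
    [X] of [K] only if [H] is contained in [X].  Thus if that
    barycenter is in the hull of the barycenters of [[F, G]], then [H] is a face of
    [G], say where [u] attains its maximum [c]; were [F] not contained in [H], all
    barycenters of [[F, G]] would lie in the convex set [u < c], which misses [H]. *)
From HB Require Import structures.
Require Import Defs.
From mathcomp Require Import all_boot all_order all_algebra.
From mathcomp Require Import finmap interval_inference.
From mathcomp Require Import boolp classical_sets functions cardinality fsbigop.
From mathcomp Require Import reals convex.
From mathcomp Require Import ring lra zify.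

Set Implicit Arguments.
Unset Strict Implicit.
Unset Printing Implicit Defensive.

Import Order.TTheory GRing.Theory Num.Theory.
Local Open Scope ring_scope.

(** * The coefficient polynomials *)

Definition half_poly : {poly rat} := (2^-1)%:P.
Definition alpha : {poly rat} := half_poly * ('X + 3).
Definition beta : {poly rat} := half_poly * (3 * 'X + 1).

Lemma half_polyE : 2 * half_poly = 1.
Proof. by rewrite /half_poly -[2 : {poly rat}]/(2%:R) -polyC_natr -polyCM mulfV. Qed.

Lemma alphaDbeta : alpha + beta = 2 * (1 + 'X).
Proof.
have := half_polyE; rewrite /alpha /beta; move: half_poly => h e.
have -> : h * ('X + 3) + h * (3 * 'X + 1) = (2 * h) * (2 * (1 + 'X)) by ring.
by rewrite e mul1r.
Qed.

Lemma alphaBbeta : alpha - beta = 1 - 'X.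
Proof.
have := half_polyE; rewrite /alpha /beta; move: half_poly => h e.
have -> : h * ('X + 3) - h * (3 * 'X + 1) = (2 * h) * (1 - 'X) by ring.
by rewrite e mul1r.
Qed.

Lemma double_beta : 2 * beta = 1 + 3 * 'X.
Proof. by rewrite /beta mulrA half_polyE mul1r addrC. Qed.

Lemma size_exp_linear (R : nzRingType) (p : {poly R}) k :
  (size p <= 2)%N -> (size (p ^+ k) <= k.+1)%N.
Proof.
move=> sp; apply: leq_trans (size_poly_exp_leq _ _) _.
by rewrite ltnS -[leqRHS]mul1n leq_mul2r; apply/orP; right; case: (size p) sp.
Qed.

(* [alpha ^+ n * P(beta / alpha)], a polynomial when [P] has degree at most [n]. *)
Definition homogenize (n : nat) (P : {poly rat}) : {poly rat} :=
  \sum_(m < n.+1) P`_m *: (beta ^+ m * alpha ^+ (n - m)).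

Lemma homogenizeXM n P : homogenize n.+1 ('X * P) = beta * homogenize n P.
Proof.
rewrite /homogenize big_ord_recl coefXM scale0r add0r mulr_sumr.
by apply: eq_bigr => i _; rewrite coefXM /= subSS exprS -scalerAr mulrA.
Qed.

(** Raising the degree by one homogenizes a constant factor 1 into [alpha]; the size bound ensures
    that no coefficient of degree n + 1 is lost on the right. *)
Lemma homogenizeS n (P : {poly rat}) : (size P <= n.+1)%N ->
  homogenize n.+1 P = alpha * homogenize n P.
Proof.
move=> sP; rewrite /homogenize big_ord_recr /= nth_default // scale0r addr0.
rewrite mulr_sumr; apply: eq_bigr => i _.
have := ltn_ord i; rewrite ltnS => le_in.
by rewrite subSn // exprS -scalerAr mulrCA.
Qed.

Lemma homogenize_is_linear n : linear (homogenize n).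
Proof.
move=> c P Q; rewrite /homogenize scaler_sumr -big_split; apply: eq_bigr => i _.
by rewrite coefD coefZ scalerDl scalerA.
Qed.
HB.instance Definition _ n :=
  GRing.isLinear.Build rat {poly rat} {poly rat} _ (homogenize n)
    (homogenize_is_linear n).

(** Homogenization is multiplicative across degrees: the factor [2 *: 'X] becomes
    [2 * beta = 1 + 3 * 'X], and [1 - 'X] becomes [alpha - beta], which is [1 - 'X] again. *)
Lemma homogenize_cell n k : (k <= n)%N ->
  homogenize n ((2 *: 'X) ^+ k * (1 - 'X) ^+ (n - k))
  = (1 + 3 * 'X) ^+ k * (1 - 'X) ^+ (n - k).
Proof.
have sz j : (size ((1 - 'X : {poly rat}) ^+ j) <= j.+1)%N.
  by apply: size_exp_linear; rewrite -opprB size_polyN size_XsubC.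
elim: k n => [n _|k IH [|n] // le_kn].
  rewrite !expr0 !mul1r subn0; elim: n => [|n IHn].
    by rewrite /homogenize !big_ord1 /= !expr0 !mulr1 coef1 scale1r.
  rewrite exprS mulrBl mul1r linearB /= homogenizeXM homogenizeS // IHn.
  by rewrite -mulrBl alphaBbeta mulrBl mul1r.
rewrite subSS exprS -!mulrA -scalerAl linearZ /= homogenizeXM IH //.
by rewrite scalerAl -mul_polyC -/(_%:R) polyC_natr double_beta exprS mulrA.
Qed.

(* The coefficient of [y ^+ j] in the generating function for [d = n + 1]; the
   quotients by [1 + x] for [j = 0] and [j = d] are geometric sums because
   [alpha - 1] and [beta - x] both equal [(1 + x) / 2]. *)
Definition column (n j : nat) : {poly rat} :=
  if j == 0%N then 1 + half_poly * 'X * \sum_(k < n) alpha ^+ k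
  else if j == n.+1 then
    'X^(n.+1) + half_poly * \sum_(k < n) 'X^(n - k) * beta ^+ k
  else 2 * 'X * beta ^+ j.-1 * alpha ^+ (n - j).

(** Multiplying by [1 + 'X] collapses the geometric sum. The transformation of long h-vectors uses
    the columns only through such products. *)
Lemma column0E n : (1 + 'X) * column n 0 = 1 + 'X * alpha ^+ n.
Proof.
have /eqP := subrXX alpha 1 n; rewrite expr1n subr_eq => /eqP ->.
have -> : alpha - 1 = half_poly * (1 + 'X).
  have := half_polyE; rewrite /alpha; move: half_poly => h e.
  have -> : h * ('X + 3) - 1 = h * (1 + 'X) + (2 * h - 1) by ring.
  by rewrite e subrr addr0.
under [in RHS]eq_bigr do rewrite expr1n mulr1.
rewrite /column /= [in RHS](reindex_inj rev_ord_inj) /=.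
have -> : \sum_(k < n) alpha ^+ k = \sum_(k < n) alpha ^+ (n.-1 - (n - k.+1)).
  by apply: eq_bigr => k _; congr (_ ^+ _); have := ltn_ord k; lia.
by ring.
Qed.

Lemma column_lastE n :
  (1 + 'X) * column n n.+1 = 'X^(n.+2) + 'X * beta ^+ n.
Proof.
have /eqP := subrXX beta 'X n; rewrite subr_eq => /eqP ->.
have -> : beta - 'X = half_poly * (1 + 'X).
  have := half_polyE; rewrite /beta; move: half_poly => h e.
  have -> : h * (3 * 'X + 1) - 'X = h * (1 + 'X) + (2 * h - 1) * 'X by ring.
  by rewrite e subrr mul0r addr0.
rewrite /column /= eqxx [in RHS](reindex_inj rev_ord_inj) /=.
have -> : \sum_(k < n) 'X^(n - k) * beta ^+ k
   = 'X * \sum_(j < n) beta ^+ (n.-1 - (n - j.+1)) * 'X^(n - j.+1).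
  rewrite mulr_sumr; apply: eq_bigr => k _; have lt_kn := ltn_ord k.
  have -> : (n.-1 - (n - k.+1) = k)%N by lia.
  have -> : (n - k = (n - k.+1).+1)%N by lia.
  by rewrite exprS; ring.
by rewrite !exprS; ring.
Qed.

(** Since [alpha + beta = 2 * (1 + 'X)], the product splits into two neighbouring terms of a
    homogenization, just as a long h-entry contributes to two neighbouring short ones. *)
Lemma column_midE n j : (j < n)%N ->
  (1 + 'X) * column n j.+1
  = 'X * (beta ^+ j.+1 * alpha ^+ (n - j.+1) + beta ^+ j * alpha ^+ (n - j)).
Proof.
move=> lt_jn; rewrite /column /= eqSS (ltn_eqF lt_jn).
have -> : (n - j = (n - j.+1).+1)%N by lia.
transitivity ((alpha + beta) * ('X * beta ^+ j * alpha ^+ (n - j.+1))).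
  by rewrite alphaDbeta; ring.
by rewrite !exprS; ring.
Qed.

Lemma column_ge0 n j i : 0 <= (column n j)`_i.
Proof.
(* The nonnegative rationals form a semiring, and the columns are built from nonnegative constants
   and ['X] by sums and products alone. *)
pose S := GRing.SemiringClosed.clone rat (@Num.Def.nneg_num_pred rat) _.
suff /polyOverP/(_ i) : column n j \is a polyOver S by [].
have h : half_poly \is a polyOver S by rewrite polyOverC.
have a : alpha \is a polyOver S.
  by rewrite /alpha rpredM // rpredD ?polyOverX ?rpred_nat.
have b : beta \is a polyOver S.
  by rewrite /beta rpredM // rpredD ?rpred1 // rpredM ?polyOverX ?rpred_nat.
rewrite /column; case: ifP => _; [|case: ifP => _].
- by rewrite rpredD ?rpred1 // !rpredM ?polyOverX // rpred_sum // => k _;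
    rewrite rpredX.
- rewrite rpredD ?rpredX ?polyOverX // rpredM // rpred_sum // => k _.
  by rewrite rpredM ?rpredX ?polyOverX.
- by rewrite !rpredM ?rpredX ?polyOverX ?rpred_nat.
Qed.

(** The closed forms of [(1 + 'X) * column n j] have degree at most n + 2; cancelling the factor of
    degree one gives the bound. *)
Lemma size_column n j : (j <= n.+1)%N -> (size (column n j) <= n.+2)%N.
Proof.
have sM a b (p q : {poly rat}) : (size p <= a.+1)%N -> (size q <= b.+1)%N ->
    (size (p * q)%R <= (a + b).+1)%N.
  by have := size_polyMleq p q; lia.
have sD a (p q : {poly rat}) : (size p <= a)%N -> (size q <= a)%N ->
    (size (p + q)%R <= a)%N.
  by move=> sp sq; apply: leq_trans (size_polyD _ _) _; rewrite geq_max sp.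
have sx k : (size ('X^k : {poly rat})%R <= k.+1)%N by rewrite size_polyXn.
have s1 : (size ('X : {poly rat})%R <= 2)%N by rewrite size_polyX.
have sn k : (size (k%:R : {poly rat})%R <= 1)%N.
  by rewrite -polyC_natr size_polyC leq_b1.
have sa k : (size (alpha ^+ k)%R <= k.+1)%N.
  apply: size_exp_linear; apply: (sM 0 1)%N.
    by rewrite size_polyC leq_b1.
  by apply: sD => //; apply: leq_trans (sn _) _.
have sb k : (size (beta ^+ k)%R <= k.+1)%N.
  apply: size_exp_linear; apply: (sM 0 1)%N.
    by rewrite size_polyC leq_b1.
  apply: sD; first exact: (sM 0 1)%N.
  by apply: leq_trans (sn 1%N) _.
move=> le_jn.
have : (size ((1 + 'X)%R * column n j)%R <= n.+3)%N.
  case: j le_jn => [_|j].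
    rewrite column0E; apply: sD; first by rewrite size_poly1.
    by apply: leq_trans (sM 1 n _ _ s1 (sa n))%N _.
  rewrite ltnS leq_eqVlt => /predU1P[->|lt_jn].
    rewrite column_lastE; apply: sD => //.
    by apply: leq_trans (sM 1 n _ _ s1 (sb n))%N _.
  rewrite column_midE //; apply: leq_trans (sM 1 n _ _ s1 _)%N _ => //.
  apply: sD.
    by apply: leq_trans (sM _ _ _ _ (sb _) (sa _)) _; lia.
  by apply: leq_trans (sM _ _ _ _ (sb _) (sa _)) _; lia.
have [->|c0] := eqVneq (column n j) 0; first by rewrite size_poly0.
rewrite size_mul //; last by rewrite -size_poly_eq0 addrC size_XaddC.
by rewrite addrC size_XaddC.
Qed.

(** * From short to long h-vectors *)

Lemma poly_sum_widen (p : {poly rat}) m : (size p <= m)%N ->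
  p = \sum_(i < m) p`_i *: 'X^i.
Proof.
move=> sp; rewrite -poly_def; apply/polyP => i; rewrite coef_poly.
by case: ltnP => // le_mi; rewrite nth_default // (leq_trans sp).
Qed.

Section LongH.
Variables (n : nat) (h : nat -> rat) (s : {poly rat}).
Hypothesis s_size : (size s <= n.+1)%N.
Hypothesis sE : forall i, (i <= n)%N -> s`_i = h i + h i.+1.

Lemma long_polyE :
  (1 + 'X) * \sum_(i < n.+2) h i *: 'X^i
  = (h 0%N)%:P + 'X * s + h n.+1 *: 'X^(n.+2).
Proof.
have -> : s = \sum_(i < n.+1) (h i + h i.+1) *: 'X^i.
  rewrite [LHS](poly_sum_widen s_size); apply: eq_bigr => i _.
  by rewrite sE // -ltnS.
under [in RHS]eq_bigr do rewrite scalerDl.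
rewrite big_split mulrDl mul1r /=.
have -> : 'X * \sum_(i < n.+2) h i *: 'X^i
    = 'X * (\sum_(i < n.+1) h i *: 'X^i) + h n.+1 *: 'X^(n.+2).
  by rewrite big_ord_recr mulrDr -scalerAr -exprS.
have -> : \sum_(i < n.+2) h i *: 'X^i
    = (h 0%N)%:P + 'X * \sum_(i < n.+1) h i.+1 *: 'X^i.
  rewrite big_ord_recl expr0 alg_polyC mulr_sumr; congr (_ + _).
  by apply: eq_bigr => i _; rewrite -scalerAr -exprS.
by ring.
Qed.

(** Evaluating [long_polyE] at -1 kills the left side and leaves the last entry in terms of the
    first one and [s.[-1]]. *)
Lemma long_last : h n.+1 = (-1) ^+ n * (s.[-1] - h 0%N).
Proof.
have /(congr1 (horner^~ (-1))) := long_polyE.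
rewrite hornerM !hornerD hornerC hornerM hornerZ hornerXn hornerX.
rewrite hornerC subrr mul0r mulN1r exprSr exprSr !mulrN1 opprK => e.
have -> : s.[-1] - h 0%N = h n.+1 * (-1) ^+ n.
  by apply/eqP; rewrite -subr_eq0 -oppr_eq0 {1}e; apply/eqP; ring.
by rewrite mulrCA -exprD addnn -muln2 mulnC exprM sqrrN !expr1n mulr1.
Qed.
End LongH.

(** The first entries agree by hypothesis. The last ones agree because -1 is fixed by the
    substitution: there [beta] is -1 and [alpha] is 1. The rest follows by comparing both sides
    after multiplication by [1 + 'X]. *)
Lemma long_transform n (hK hS : nat -> rat) (sK sS : {poly rat}) :
  (size sK <= n.+1)%N -> (size sS <= n.+1)%N ->
  (forall i, (i <= n)%N -> sK`_i = hK i + hK i.+1) ->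
  (forall i, (i <= n)%N -> sS`_i = hS i + hS i.+1) ->
  hS 0%N = hK 0%N -> sS = homogenize n sK ->
  forall i, (i <= n.+1)%N ->
    hS i = \sum_(j < n.+2) (column n j)`_i * hK j.
Proof.
move=> szK szS eK eS e0 eSK i le_in.
have eL : hS n.+1 = hK n.+1.
  rewrite (long_last szK eK) (long_last szS eS) e0 eSK; congr (_ * (_ - _)).
  rewrite /homogenize [in RHS](poly_sum_widen szK) !horner_sum.
  apply: eq_bigr => k _; rewrite !hornerZ hornerXn; congr (_ * _).
  rewrite hornerM !horner_exp.
  have -> : beta.[-1] = -1 by rewrite /beta /half_poly !hornerE.
  have -> : alpha.[-1] = 1 by rewrite /alpha /half_poly !hornerE.
  by rewrite expr1n mulr1.
suff key : \sum_(i < n.+2) hS i *: 'X^i = \sum_(j < n.+2) hK j *: column n j.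
  have := congr1 (fun p : {poly rat} => p`_i) key.
  rewrite -poly_def coef_poly ltnS le_in => ->.
  by rewrite coef_sum; apply: eq_bigr => j _; rewrite coefZ mulrC.
have nz : (1 + 'X : {poly rat}) != 0 by rewrite addrC -size_poly_eq0 size_XaddC.
apply: (mulfI nz); rewrite (long_polyE szS eS) e0 eL eSK.
rewrite [RHS]mulr_sumr; under [in RHS]eq_bigr do rewrite -scalerAr.
rewrite big_ord_recl big_ord_recr /= column0E column_lastE.
under [in RHS]eq_bigr => j _ do rewrite /bump column_midE //.
(* The homogenization of ['X^m], for m at most n. *)
pose e m := beta ^+ m * alpha ^+ (n - m).
have -> : homogenize n sK =
    \sum_(m < n.+1) hK m *: e m + \sum_(m < n.+1) hK m.+1 *: e m.
  by rewrite -big_split /=; apply: eq_bigr => m _; rewrite eK ?scalerDl // -ltnS.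
have -> : \sum_(j < n) hK j.+1 *: ('X * (e j.+1 + e j))
   = 'X * (\sum_(j < n) hK j.+1 *: e j.+1 + \sum_(j < n) hK j.+1 *: e j).
  rewrite -big_split mulr_sumr; apply: eq_bigr => j _.
  by rewrite /= -scalerDr scalerAr.
rewrite big_ord_recl [X in 'X * (_ + X)]big_ord_recr /=.
rewrite {1 4}/e subnn subn0 !expr0 mul1r mulr1 -!mul_polyC /bump /=.
by ring.
Qed.

(** * The generating function *)

Definition Cmatrix n : 'M[rat]_n.+2 := \matrix_(i, j) (column n j)`_i.

Lemma ratcM_sum (E : nat -> nat -> rat) m :
  \sum_(j < m) \sum_(i < m) ratc (E i j) * xvar ^+ i * yvar ^+ j
  = FracField.tofrac (\poly_(j < m) \poly_(i < m) E i j).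
Proof.
rewrite poly_def rmorph_sum; apply: eq_bigr => j _.
rewrite -mul_polyC rmorphM poly_def !rmorph_sum /= mulr_suml rmorphXn.
by apply: eq_bigr => i _; rewrite -mul_polyC !rmorphM /= !rmorphXn.
Qed.

Lemma has_genfun_uniq d (C C' : 'M[rat]_d.+1) :
  has_genfun C -> has_genfun C' -> C' = C.
Proof.
rewrite /has_genfun => <-.
(* As [FracField.tofrac] is injective, it suffices to compare polynomials; [inord] extends the
   entries of [D] to natural number indices. *)
have E (D : 'M[rat]_d.+1) :
    \sum_(j < d.+1) \sum_(i < d.+1) ratc (D i j) * xvar ^+ i * yvar ^+ j
    = FracField.tofrac (\poly_(j < d.+1) \poly_(i < d.+1) D (inord i) (inord j)).
  rewrite -ratcM_sum; apply: eq_bigr => j _; apply: eq_bigr => i _.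
  by rewrite !inord_val.
rewrite !E => /eqP; rewrite tofrac_eq => /eqP e.
apply/matrixP => i j; have := congr1 (fun p : {poly {poly rat}} => p`_j`_i) e.
by rewrite !coef_poly !ltn_ord !coef_poly !ltn_ord !inord_val.
Qed.

(** The powers are abstracted into atoms for [field]: [X'], [Y], [P], [Q], [T] stand for x^n, y^n,
    (x+3)^n, (3x+1)^n and 2^n. *)
Lemma genfun_split (F : fieldType) (x y X' Y P Q T : F) :
  T != 0 -> 2 != 0 :> F -> 1 + x != 0 ->
  x + 3 - (3 * x + 1) * y != 0 ->
  (1 + x * (P / T)) / (1 + x)
  + (2 * x * y * ((P / T - Q / T * Y) / ((x + 3) / 2 - (3 * x + 1) / 2 * y))
     + (x * (x * X') + x * (Q / T)) / (1 + x) * (y * Y))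
  = 1 / (1 + x) * (1 + x * (x * X') * (y * Y))
    + x * y / (T / 4) * ((P - Q * Y) / (x + 3 - (3 * x + 1) * y))
    + x / (T * (1 + x)) * (P + Q * (y * Y)).
Proof.
move=> nT n2 n1 nab.
have -> : (x + 3) / 2 - (3 * x + 1) / 2 * y = (x + 3 - (3 * x + 1) * y) / 2.
  by field.
have : (4 : F) != 0 by rewrite (_ : 4 = 2 * 2) ?mulf_neq0 //; ring.
move: (x + 3 - _) nab => D nD n4.
by field; rewrite n1 nT nD n4 n2.
Qed.

Lemma expz2_sub3 (F : fieldType) n : 2 != 0 :> F ->
  (2 : F) ^ (n.+1%:Z - 3) = 2 ^+ n / 4.
Proof.
move=> nz2; have -> : (n.+1%:Z - 3 = n%:Z + (- 2%:Z))%R by lia.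
by rewrite expfzDr // -exprnN -exprnP expr2 -natrM.
Qed.

Lemma column_genfun (F : fieldType) (f : {rmorphism {poly rat} -> F}) (y : F) n
    (x := f 'X) :
  2 != 0 :> F -> 1 + x != 0 -> x + 3 - (3 * x + 1) * y != 0 ->
  \sum_(j < n.+2) f (column n j) * y ^+ j
  = 1 / (1 + x) * (1 + x ^+ n.+2 * y ^+ n.+1)
    + x * y / (2 ^+ n / 4) * (((x + 3) ^+ n - (3 * x + 1) ^+ n * y ^+ n)
                            / (x + 3 - (3 * x + 1) * y))
    + x / (2 ^+ n * (1 + x)) * ((x + 3) ^+ n + (3 * x + 1) ^+ n * y ^+ n.+1).
Proof.
move=> nz2 nz1x nzab.
have aE : f alpha = (x + 3) / 2.
  apply: (mulfI nz2); rewrite mulrCA mulfV // mulr1 -(rmorph_nat f 2) -rmorphM.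
  by rewrite /alpha mulrA half_polyE mul1r rmorphD rmorph_nat.
have bE : f beta = (3 * x + 1) / 2.
  apply: (mulfI nz2); rewrite mulrCA mulfV // mulr1 -(rmorph_nat f 2) -rmorphM.
  by rewrite double_beta rmorphD rmorph1 rmorphM rmorph_nat addrC.
have f1X : f (1 + 'X) = 1 + x by rewrite rmorphD rmorph1.
have c0 : f (column n 0) = (1 + x * f alpha ^+ n) / (1 + x).
  apply: (mulfI nz1x); rewrite mulrCA mulfV // mulr1 -{1}f1X -rmorphM column0E.
  by rewrite rmorphD rmorph1 rmorphM rmorphXn.
have cl : f (column n n.+1) = (x ^+ n.+2 + x * f beta ^+ n) / (1 + x).
  apply: (mulfI nz1x); rewrite mulrCA mulfV // mulr1 -{1}f1X -rmorphM column_lastE.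
  by rewrite rmorphD rmorphXn rmorphM rmorphXn.
rewrite big_ord_recl big_ord_recr /= c0 cl expr0 mulr1 /bump /= add1n.
(* The middle columns give a homogeneous geometric sum in [f alpha] and [f beta * y]. *)
have -> : \sum_(i < n) f (column n i.+1) * y ^+ i.+1
  = 2 * x * y * ((f alpha ^+ n - (f beta * y) ^+ n) / (f alpha - f beta * y)).
  have nz : f alpha - f beta * y != 0.
    by rewrite aE bE mulrAC -mulrBl mulf_neq0 // invr_neq0.
  rewrite subrXX [X in X / _]mulrC mulfK // mulr_sumr.
  apply: eq_bigr => i _; have lt_in := ltn_ord i.
  rewrite /column /= eqSS (ltn_eqF lt_in) 3!rmorphM rmorph_nat !rmorphXn exprMn exprS.
  have -> : (n.-1 - i = n - i.+1)%N by lia.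
  by rewrite -/x; ring.
rewrite aE bE !exprMn !exprVn !exprS.
by apply: genfun_split; rewrite ?expf_neq0.
Qed.

Lemma Cmatrix_genfun n : has_genfun (Cmatrix n).
Proof.
pose f : {rmorphism {poly rat} -> ratfun2} :=
  (@FracField.tofrac {poly {poly rat}}) \o polyC.
have -> : has_genfun (Cmatrix n) <->
    \sum_(j < n.+2) f (column n j) * yvar ^+ j = genfun n.+1.
  rewrite /has_genfun; set L := LHS; set L' := (X in _ <-> X = _).
  suff -> : L = L' by [].
  apply: eq_bigr => j _; rewrite -mulr_suml; congr (_ * _).
  (* By [size_column], no coefficient falls outside the n + 2 rows of the matrix. *)
  rewrite {1}(@poly_sum_widen (column n j) n.+2); last first.
    by rewrite size_column // -ltnS.
  rewrite rmorph_sum; apply: eq_bigr => i _.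
  by rewrite mxE -mul_polyC rmorphM rmorphXn.
have fE p : f p = FracField.tofrac p%:P by [].
have fx : f 'X = xvar by [].
have nz2 : (2 : ratfun2) != 0.
  by rewrite -(rmorph_nat f 2) fE tofrac_eq0 polyC_eq0 -polyC_natr polyC_eq0.
have nz1x : 1 + f 'X != 0.
  rewrite -(rmorph1 f) -rmorphD fE tofrac_eq0 polyC_eq0 -size_poly_eq0 addrC.
  by rewrite size_XaddC.
have nzab : f 'X + 3 - (3 * f 'X + 1) * yvar != 0.
  rewrite -(rmorph1 f) -(rmorph_nat f 3) -rmorphM -!rmorphD !fE -rmorphM -rmorphB.
  rewrite tofrac_eq0.
  (* The coefficient of y^0 is x + 3, whose coefficient at x is 1. *)
  apply/negP => /eqP/(congr1 (fun p : {poly {poly rat}} => p`_0)).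
  rewrite coefB coefMX coefC subr0 coef0 => /(congr1 (fun p : {poly rat} => p`_1)).
  by rewrite coefD coefX -polyC_natr coefC coef0.
have e2 : (2 : ratfun2) ^ (n.+1%:Z - 3) = 2 ^+ n / 4.
  exact (expz2_sub3 n nz2).
rewrite (column_genfun _ nz2 nz1x nzab) /genfun e2 fx.
reflexivity.
Qed.

Local Open Scope classical_set_scope.

(** * Polytopes and barycenters *)

Section Geometry.
Context {R : realType} {n : nat}.
Implicit Types (A P F : set 'rV[R]_n) (u : {scalar 'rV[R]_n}).

Lemma scalar_conv u (x y : 'rV[R]_n) (l : {i01 R}) :
  u (@conv R (convex_lmodType 'rV[R]_n) l x y)
  = l%:num * u x + (1 - l%:num) * u y.
Proof. by rewrite [conv _ _ _]/(_ *: _ + _ *: _) linearD !linearZ. Qed.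

Lemma convex_halfspace_le u c : convex_set [set x : 'rV[R]_n | u x <= c].
Proof.
move=> x y l; rewrite !inE /= => ux uy; rewrite scalar_conv.
have l0 : 0 <= l%:num by [].
have l1 : l%:num <= 1 by [].
nra.
Qed.

Lemma convex_halfspace_lt u c : convex_set [set x : 'rV[R]_n | u x < c].
Proof.
move=> x y l; rewrite !inE /= => ux uy; rewrite scalar_conv.
have l0 : 0 <= l%:num by [].
have l1 : l%:num <= 1 by [].
move: l%:num l0 l1 => t; rewrite le_eqVlt => /predU1P[<- _|t0 t1].
  by rewrite mul0r add0r subr0 mul1r.
have := mulr_gt0 t0 (_ : 0 < c - u x); rewrite subr_gt0 => /(_ ux).
have := mulr_ge0 (_ : 0 <= 1 - t) (_ : 0 <= c - u y).
by rewrite !subr_ge0 => /(_ t1 (ltW uy)); lra.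
Qed.

Lemma hull_convex A : convex_set (hull A).
Proof.
move=> x y l; rewrite !inE => hx hy X [cX AX].
by have := cX x y l; rewrite !inE; apply; [exact: hx|exact: hy].
Qed.

Lemma sub_hull A : A `<=` hull A.
Proof. exact: sub_gen_smallest. Qed.

Lemma hull_sub A (X : set 'rV[R]_n) : convex_set X -> A `<=` X -> hull A `<=` X.
Proof. exact: smallest_sub. Qed.

(** A linear form has a maximum on the finite generating set, and the half-space below that value is
    convex, so it contains the hull. *)
Lemma polytope_max P u : polytope P -> P !=set0 ->
  exists2 x, P x & forall y, P y -> u y <= u x.
Proof.
move=> [A /finite_seqP[s ->] ->] [x0 hx0].
have [x xs xmax] : exists2 x, x \in s & forall y, y \in s -> u y <= u x.
  case: s hx0 => [|a s _].
    (* The hull of no points is empty, contrary to [P !=set0]. *)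
    by move=> /(@hull_sub _ set0); case=> //; move=> x y l; rewrite !inE.
  elim: s a => [|b s IH] a.
    by exists a => [|y]; rewrite ?inE // => /eqP ->.
  have [x xs xmax] := IH b.
  have [le_ax|lt_xa] := leP (u a) (u x).
    exists x => [|y]; first by rewrite inE xs orbT.
    by rewrite inE => /predU1P[->|/xmax].
  exists a => [|y]; first by rewrite inE eqxx.
  by rewrite inE => /predU1P[-> //|/xmax le]; rewrite (le_trans le) ?ltW.
exists x; first exact: sub_hull.
by apply: hull_sub => //; exact: convex_halfspace_le.
Qed.

Lemma mean_convex (X : set 'rV[R]_n) (s : seq 'rV[R]_n) : convex_set X ->
  (0 < size s)%N -> (forall v, v \in s -> X v) ->
  X ((size s)%:R^-1 *: \sum_(v <- s) v).
Proof.
case: s => // a s cX _; elim: s a => [|b s IH] a sX.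
  by rewrite big_seq1 invr1 scale1r; apply: sX; rewrite inE.
have Xa : X a by apply: sX; rewrite inE eqxx.
have Xb := IH b (fun v vs => sX v (@mem_behead _ [:: a, b & s] v vs)).
set m := size (b :: s) in Xb *; set S := \sum_(v <- b :: s) v in Xb *.
have m0 : (0 : R) < m%:R by rewrite ltr0n.
have i0 : 0 <= (m.+1%:R^-1 : R) by rewrite invr_ge0.
have i1 : (m.+1%:R^-1 : R) <= 1 by rewrite invf_le1 // ler1n.
(* With m points in the tail, the new mean combines [a] with weight 1/(m+1) and the old mean with
   weight m/(m+1). *)
have := cX a (m%:R^-1 *: S) (Itv01 i0 i1).
rewrite !inE => /(_ Xa Xb); congr X.
rewrite big_cons -/S scalerDr; congr (_ + _); rewrite scalerA; congr (_ *: _).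
have E (t : R) : 0 < t -> (1 - (t + 1)^-1) / t = (t + 1)^-1.
  by move=> t0; field; rewrite (lt0r_neq0 t0) lt0r_neq0 // addr_gt0.
by have := E _ m0; rewrite natr1.
Qed.

(** Coordinates make it possible to write down particular forms: zero, a coordinate, the opposite of
    a form, or a form supporting a given face of the cube. *)
Definition lform_fun (w : 'I_n -> R) (x : 'rV[R]_n) : R := \sum_i w i * x 0 i.

Lemma lform_is_scalar w : scalar (lform_fun w).
Proof.
move=> c x y; rewrite /lform_fun mulr_sumr -big_split; apply: eq_bigr => i _ /=.
by rewrite !mxE; ring.
Qed.

HB.instance Definition _ w :=
  GRing.isLinear.Build R 'rV[R]_n R _ (lform_fun w) (lform_is_scalar w).

Definition lform w : {scalar 'rV[R]_n} := lform_fun w.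

Lemma lform_eq u : u =1 lform (fun i => u (delta_mx 0 i)).
Proof.
move=> x; rewrite {1}(row_sum_delta x) linear_sum; apply: eq_bigr => i _.
by rewrite linearZ /= mulrC.
Qed.

Lemma face_set0 P : face P set0.
Proof.
exists (lform (fun=> 0)), 1.
have l0 x : lform (fun=> 0 : R) x = 0 by apply: big1 => i _; rewrite mul0r.
split=> [x _|]; first by rewrite l0 ler01.
by apply/seteqP; split => // x [_ /=]; rewrite l0 => /eqP; rewrite eq_sym oner_eq0.
Qed.

End Geometry.

(** * Vertices and barycenters of the faces of a complex *)

Section Complex.
Context {R : realType} {n : nat} (K : set (set 'rV[R]_n)).
Hypothesis cK : cubical_complex K.
Implicit Types (P F G H X : set 'rV[R]_n).

Let Kfin : finite_set K. Proof. by case: cK. Qed.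
Let Kpoly P : K P -> polytope P. Proof. by case: cK => _ h _ _ /h[]. Qed.
Let Kface P F : K P -> face P F -> K F. Proof. by case: cK => _ _ h _ /h; apply. Qed.
Let KI P X : K P -> K X -> face P (P `&` X).
Proof. by case: cK => _ _ _ h /h{}h /h[]. Qed.

Lemma face_sub P F : face P F -> F `<=` P.
Proof. by move=> [u [c [_ ->]]] x []. Qed.

Lemma sub_face P F : K P -> K F -> F `<=` P -> face P F.
Proof. by move=> KP KF FP; have := KI KP KF; rewrite setIidr. Qed.

Lemma max_face P (u : {scalar 'rV[R]_n}) : K P -> P !=set0 ->
  exists c, [/\ face P (P `&` [set x | u x = c]), (P `&` [set x | u x = c]) !=set0
    & forall x, P x -> u x <= c].
Proof.
move=> KP P0; have [x Px xmax] := polytope_max u (Kpoly KP) P0.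
by exists (u x); split => //; [exists u, (u x)|exists x].
Qed.

(** Induction on the number of members of [K] inside [P]. If two points of [P] differ in coordinate
    i, the face where that coordinate is maximal is nonempty and proper; its vertices are vertices
    of [P], since members of [K] inside [P] are faces of [P]. *)
Lemma vertex_exists P : K P -> P !=set0 -> exists v, vertices P v.
Proof.
have [m] := ubnP #|` fset_set [set G | K G /\ G `<=` P]|.
elim: m P => // m IH P lt_m KP P0.
have fin Q : finite_set [set G | K G /\ G `<=` Q].
  by apply: sub_finite_set Kfin => G [].
have [x Px] := P0.
have [single|/existsNP[y /not_implyP[Py nyx]]] := pselect (forall y, P y -> y = x).
  exists x; rewrite /vertices /=; have -> : [set x] = P.
    by apply/seteqP; split => [y -> //|y /single].
  by apply: sub_face.
have [i neq_i] : exists i, y 0 i != x 0 i.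
  apply/existsP; rewrite -negb_forall; apply/negP => /forallP e; apply: nyx.
  by apply/rowP => i; apply/eqP.
pose u := lform (fun j => (j == i)%:R : R).
have uE z : u z = z 0 i.
  rewrite /u /lform /= /lform_fun (bigD1 i) //= eqxx mul1r big1 ?addr0 // => j.
  by move=> /negPf ->; rewrite mul0r.
have [c [Pc c0 cmax]] := max_face u KP P0.
set F := P `&` _ in Pc c0.
have KF := Kface KP Pc.
have nPF : ~ P `<=` F.
  by move=> PF; case/eqP: neq_i; rewrite -!uE; have [_ ->] := PF _ Px; have [_ ->] := PF _ Py.
have [|v Fv] := IH F _ KF c0.
  rewrite -ltnS; apply: leq_trans lt_m; rewrite ltnS.
  apply: fproper_ltn_card; rewrite fproperE; apply/andP; split.
    apply/fsubsetP => G; rewrite !in_fset_set // !inE => -[KG GF]; split => //.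
    by apply: subset_trans GF (face_sub Pc).
  apply/negP => /fsubsetP/(_ P).
  by rewrite !in_fset_set // !inE => h; case: h => //; split.
exists v; apply: sub_face KP (Kface KF Fv) _.
by apply: subset_trans (face_sub Fv) (face_sub Pc).
Qed.

(** Each vertex gives a singleton belonging to the finite set [K]. Finiteness matters because
    [fset_set] of an infinite set is empty. *)
Lemma finite_vertices P : K P -> finite_set (vertices P).
Proof.
move=> KP.
apply: (@sub_finite_set _ _ ((fun v : 'rV[R]_n => [set v]) @^-1` K)).
  by move=> v; exact: Kface.
by apply: finite_preimage => // v w _ _ /seteqP[/(_ v erefl)].
Qed.

Section Barycenter.
Variable H : set 'rV[R]_n.
Hypotheses (KH : K H) (H0 : H !=set0).

Let s : seq 'rV[R]_n := fset_set (vertices H).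
Let sP v : reflect (vertices H v) (v \in s).
Proof.
rewrite in_fset_set; last exact: finite_vertices.
by apply: (iffP idP); rewrite inE.
Qed.
Let s_gt0 : (0 < size s)%N.
Proof.
have [v /sP] := vertex_exists KH H0.
by rewrite lt0n size_eq0; case: s.
Qed.
Let bE : barycenter H = (size s)%:R^-1 *: \sum_(v <- s) v.
Proof. by rewrite /barycenter fsbig_finite //; exact: finite_vertices. Qed.
Let sH v : v \in s -> H v.
Proof. by move=> /sP /face_sub; apply. Qed.

Lemma barycenter_in : H (barycenter H).
Proof.
have [A _ HA] := Kpoly KH.
rewrite bE; apply: mean_convex => //; rewrite HA; exact: hull_convex.
Qed.

(** If the barycenter attains the maximum c of [u], the nonnegative numbers c - u v over the
    vertices sum to zero, so [u] equals c at every vertex. *)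
Lemma barycenter_face X : face H X -> X (barycenter H) -> X = H.
Proof.
move=> [u [c [uc ->]]] [_ ub].
have vc v : v \in s -> u v = c.
  have : \sum_(w <- s | w \in s) (c - u w) == 0.
    rewrite -big_seq sumrB big_const_seq count_predT iter_addr_0 subr_eq0.
    move: ub; rewrite /= bE linearZ linear_sum /= => <-.
    by rewrite -mulrnAr -[(\sum_(i <- s) _) *+ _]mulr_natl mulrA mulVf ?mul1r // pnatr_eq0 -lt0n.
  rewrite psumr_eq0 => [/allP/(_ v)|w /sH/uc]; last by rewrite subr_ge0.
  by move=> h vs; move: (h vs); rewrite vs subr_eq0 => /eqP.
apply/seteqP; split => [x []//|x Hx]; split => //=.
apply/eqP; rewrite eq_le uc //=.
(* To pass from the vertices to all of [H], minimize [u]: the face of minimizers has a vertex, which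
   is a vertex of [H], so the minimum is c as well. *)
pose u' := lform (fun i => - u (delta_mx 0 i)).
have u'E y : u' y = - u y.
  rewrite (lform_eq u) /u' /lform /= /lform_fun -sumrN.
  by apply: eq_bigr => i _; rewrite mulNr.
have [e [He e0 emax]] := max_face u' KH H0.
have KF := Kface KH He.
have [v Fv] := vertex_exists KF e0.
have /sP/vc uv : vertices H v.
  apply: sub_face (Kface KF Fv) _ => //.
  by apply: subset_trans (face_sub Fv) (face_sub He).
have [_ /= ev] := face_sub Fv (erefl v).
by have := emax x Hx; rewrite -ev !u'E uv lerN2.
Qed.

End Barycenter.

Lemma barycenter_sub H X : K H -> K X -> H !=set0 -> X (barycenter H) -> H `<=` X.
Proof.
move=> KH KX H0 Xb; have := KI KH KX => /(barycenter_face KH H0) <-.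
  by move=> x [].
by split => //; exact: barycenter_in.
Qed.

(** * Inclusion between cells of the subdivision *)

Definition sd_cell F G : set 'rV[R]_n :=
  hull (@barycenter R n @` [set H | [/\ K H, F `<=` H & H `<=` G]]).

Lemma barycenter_sd_cell F G H : K F -> K G -> F !=set0 -> K H -> H !=set0 ->
  sd_cell F G (barycenter H) <-> F `<=` H /\ H `<=` G.
Proof.
move=> KF KG F0 KH H0; split; last first.
  by move=> [FH HG]; apply: sub_hull; exists H.
have sup0 X : F `<=` X -> X !=set0 by case: F0 => x Fx /(_ _ Fx); exists x.
move=> Qb.
have HG : H `<=` G.
  apply: barycenter_sub => //; move: Qb; apply: hull_sub.
    by have [A _ ->] := Kpoly KG; exact: hull_convex.
  by move=> _ [X [KX FX XG] <-]; apply: XG; apply: barycenter_in => //; exact: sup0.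
split=> //; apply: contrapT => nFH.
have [u [c [uc HE]]] := sub_face KG KH HG.
have : u (barycenter H) < c.
  move: Qb; apply: (@hull_sub _ _ _ [set x | u x < c]).
    exact: convex_halfspace_lt.
  move=> _ [X [KX FX XG] <-] /=; have X0 := sup0 _ FX.
  have GX : G (barycenter X) by apply: XG; exact: barycenter_in.
  rewrite lt_neqAle uc // andbT; apply/negP => /eqP uX; apply: nFH.
  apply: subset_trans FX _; apply: barycenter_sub => //.
  by rewrite HE; split.
have : H (barycenter H) by exact: barycenter_in.
by rewrite {1}HE => -[_ /= ->]; rewrite ltxx.
Qed.

(** The barycenters lying in a cell determine its interval; testing those of the two ends [F] and
    [G] gives the forward direction. *)
Lemma sd_cell_sub F G F' G' : K F -> K G -> K F' -> K G' ->
  F !=set0 -> F' !=set0 -> F `<=` G ->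
  (sd_cell F G `<=` sd_cell F' G' <-> F' `<=` F /\ G `<=` G').
Proof.
move=> KF KG KF' KG' F0 F'0 FG; split=> [sub|[F'F GG']].
  have G0 : G !=set0 by case: F0 => x /FG; exists x.
  have [F'F _] : F' `<=` F /\ F `<=` G'.
    apply/barycenter_sd_cell => //; apply: sub.
    by apply/barycenter_sd_cell => //; split => //; exact: subset_refl.
  have [_ GG'] : F' `<=` G /\ G `<=` G'.
    apply/barycenter_sd_cell => //; apply: sub.
    by apply/barycenter_sd_cell => //; split => //; exact: subset_refl.
  by [].
apply: hull_sub; first exact: hull_convex.
move=> _ [X [KX FX XG] <-]; apply: sub_hull; exists X => //; split => //.
  exact: subset_trans FX.
exact: subset_trans GG'.
Qed.

Lemma sd_cell_neq0 F G : K F -> K G -> F !=set0 -> F `<=` G -> sd_cell F G !=set0.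
Proof.
move=> KF KG F0 FG; exists (barycenter F).
by apply/barycenter_sd_cell => //; split => //; exact: subset_refl.
Qed.

End Complex.

(** * Cells of a cube *)

(* A nonempty face of [[0,1]^I]: [Some b] fixes a coordinate to [b], [None]
   leaves it free. *)
Definition cell (I : finType) := {ffun I -> option bool}.

Definition cell_le (I : finType) (s t : cell I) : Prop :=
  forall i, t i = None \/ s i = t i.

Lemma cell_le_anti (I : finType) (s t : cell I) :
  cell_le s t -> cell_le t s -> s = t.
Proof.
move=> st ts; apply/ffunP => i; have [e|//] := st i.
by have [->|->] := ts i.
Qed.

(** A parametrization of [A] as the face lattice of a cube. The coordinates form any finite type,
    because cells of the subdivision are indexed by the coordinates that a given cell fixes. *)
Definition cell_model (T : Type) (A : set (set T)) (I : finType)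
    (phi : cell I -> set T) : Prop :=
  [/\ A = set0 |` range phi, forall s, phi s !=set0
    & forall s t, phi s `<=` phi t <-> cell_le s t].

Lemma cell_model_inj (T : Type) (A : set (set T)) (I : finType)
    (phi : cell I -> set T) : cell_model A phi -> injective phi.
Proof.
move=> [_ _ le] s t e.
by apply: cell_le_anti; apply/le; rewrite e; exact: subset_refl.
Qed.

Lemma cell_model_reindex (T : Type) (A : set (set T)) (I J : finType)
    (phi : cell I -> set T) : #|I| = #|J| -> cell_model A phi ->
  exists psi : cell J -> set T, cell_model A psi.
Proof.
move=> eIJ [-> n0 le].
pose g (i : I) : J := enum_val (cast_ord eIJ (enum_rank i)).
pose h (j : J) : I := enum_val (cast_ord (esym eIJ) (enum_rank j)).
have gK : cancel g h by move=> i; rewrite /g /h enum_valK cast_ordK enum_rankK.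
have hK : cancel h g by move=> i; rewrite /g /h enum_valK cast_ordKV enum_rankK.
pose tr (s : cell J) : cell I := [ffun i => s (g i)].
exists (phi \o tr); split => [|s|s t] /=; last 2 first.
- exact: n0.
- rewrite le; split=> st i; last by rewrite !ffunE; exact: st.
  by have := st (h i); rewrite !ffunE hK.
congr (_ |` _); apply/seteqP; split => [_ [s _ <-]|_ [s _ <-]]; last by exists (tr s).
exists [ffun j => s (h j)] => //; congr phi.
by apply/ffunP => i; rewrite !ffunE gK.
Qed.

(** An inclusion isomorphism preserves the least element, so the empty sets correspond and the
    nonempty members can be pulled back along it. *)
Lemma inclusion_iso_model (T U : Type) (A : set (set T)) (B : set (set U))
    (I : finType) (psi : cell I -> set U) :
  A set0 -> inclusion_iso A B -> cell_model B psi ->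
  exists phi : cell I -> set T, cell_model A phi.
Proof.
move=> A0 [f [[fAB finj fsurj] fle]] [BE n0 le].
have [Z AZ fZ] : exists2 Z, A Z & f Z = set0 by apply: fsurj; rewrite BE; left.
have f0 : f set0 = set0.
  by apply/seteqP; split => //; rewrite -fZ; apply/fle.
have /choice[phi phiP] : forall s, exists X, A X /\ f X = psi s.
  move=> s; have [X AX fX] : exists2 X, A X & f X = psi s.
    by apply: fsurj; rewrite BE; right; exists s.
  by exists X.
exists phi; split=> [|s|s t].
- apply/seteqP; split=> [X AX|X [->//|[s _ <-]]]; last by have [] := phiP s.
  have := fAB _ AX; rewrite BE => -[fX|[s _ fX]].
    by left; apply: finj; rewrite ?inE // f0 fX.
  right; exists s => //; have [As fs] := phiP s.
  by apply: finj; rewrite ?inE // fs.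
- have [As fs] := phiP s; apply/set0P/eqP => e.
  by have [x] := n0 s; rewrite -fs e f0.
- have [As fs] := phiP s; have [At ft] := phiP t.
  by rewrite -fle // fs ft.
Qed.

Lemma cell_model_iso (T U : Type) (A : set (set T)) (B : set (set U))
    (I : finType) (phi : cell I -> set T) (psi : cell I -> set U) :
  cell_model A phi -> cell_model B psi -> inclusion_iso A B.
Proof.
move=> mA mB; have phi_inj := cell_model_inj mA; have psi_inj := cell_model_inj mB.
have [-> n0 le] := mA; have [-> n0' le'] := mB.
(* The map is needed on all sets; those not in the range of [phi] go to the empty set. *)
have /choice[f fP] : forall X, exists Y : set U,
    (X = set0 -> Y = set0) /\ (forall s, phi s = X -> Y = psi s).
  move=> X; have [->|X0] := eqVneq X set0.
    by exists set0; split => // s e; have := n0 s; rewrite e => -[].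
  have [[s sX]|nX] := pselect (exists s, phi s = X).
    by exists (psi s); split => [e|t]; [rewrite e eqxx in X0|rewrite -sX => /phi_inj ->].
  by exists set0; split => // s sX; case: nX; exists s.
have f0 : f set0 = set0 by have [->] := fP set0.
have fs s : f (phi s) = psi s by have [_ /(_ s erefl)] := fP (phi s).
exists f; split; first split.
- by move=> _ [->|[s _ <-]]; [left|right; exists s].
- move=> X Y; rewrite !inE => -[->|[s _ <-]] [->|[t _ <-]] //; rewrite ?f0 ?fs.
  + by move=> e; have [x] := n0' t; rewrite -e.
  + by move=> e; have [x] := n0' s; rewrite e.
  + by move=> /psi_inj ->.
- move=> _ [->|[s _ <-]]; first by exists set0 => //; left.
  by exists (phi s) => //; right; exists s.
move=> X Y [->|[s _ <-]] [->|[t _ <-]]; rewrite ?f0 ?fs.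
- by split=> _; exact: sub0set.
- by split=> _; exact: sub0set.
- by split; rewrite subset0 => e; [have [x] := n0' s|have [x] := n0 s]; rewrite e.
- by rewrite le le'.
Qed.

(** A model over [I] has 3^#|I| nonempty members, so counting them compares dimensions. *)
Lemma cell_model_leq_card (T : Type) (A : set (set T)) (I J : finType)
    (phi : cell I -> set T) (psi : cell J -> set T) :
  cell_model A phi -> cell_model A psi -> (#|I| <= #|J|)%N.
Proof.
move=> mI mJ; have phi_inj := cell_model_inj mI.
have [AI n0 _] := mI; have [AJ _ _] := mJ.
have /choice[f fP] : forall s, exists t, psi t = phi s.
  move=> s; have : A (phi s) by rewrite AI; right; exists s.
  rewrite AJ => -[e|[t _ <-]]; last by exists t.
  by have [x] := n0 s; rewrite e.
have /leq_card : injective f by move=> s t e; apply: phi_inj; rewrite -!fP e.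
by rewrite !card_ffun card_option card_bool leq_exp2l.
Qed.

(** * The face lattice of the standard cube *)

Section CubeFaces.
Context {R : realType} {m : nat}.
Implicit Types (s t : cell 'I_m) (x : 'rV[R]_m).

Definition cube_face s : set 'rV[R]_m :=
  [set x | cube x /\ forall i b, s i = Some b -> x 0 i = b%:R].

(** This point detects inclusion of faces, because its free coordinates, equal to 1/2, are neither 0
    nor 1. *)
Definition cube_center s : 'rV[R]_m :=
  \row_i (if s i is Some b then b%:R else 2^-1).

Lemma cube_center_in s : cube_face s (cube_center s).
Proof.
split=> [i|i b sb]; rewrite mxE; last by rewrite sb.
by case: (s i) => [[]|]; rewrite ?lexx ?ler01 //=; lra.
Qed.

Lemma cube_face_sub s t : cube_face s `<=` cube_face t <-> cell_le s t.
Proof.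
split=> [sub i|le x [cx xs]].
  have [_ /(_ i)] := sub _ (cube_center_in s).
  case: (t i) => [b /(_ b erefl)|_]; last by left.
  rewrite mxE; case: (s i) => [b'|]; last by case: b => /= e; exfalso; move: e; lra.
  by move=> /eqP; rewrite eqr_nat; case: b b' => [] [] // _; right.
split=> // i b tb; apply: xs; have [|->//] := le i.
by rewrite tb.
Qed.

(** The face of the cube on which the form with coefficients [w] is maximal. *)
Definition sign_cell (w : 'I_m -> R) : cell 'I_m :=
  [ffun i => if 0 < w i then Some true else if w i < 0 then Some false else None].

Definition lform_max (w : 'I_m -> R) : R := \sum_i Num.max (w i) 0.

Lemma cube_coord_le w x i : cube x -> w i * x 0 i <= Num.max (w i) 0.
Proof.
move=> /(_ i)/andP[x0 x1].
by rewrite le_max; case: (lerP 0 (w i)) => w0; apply/orP; [left|right]; nra.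
Qed.

Lemma lform_cube_le w x : cube x -> lform w x <= lform_max w.
Proof. by move=> cx; apply: ler_sum => i _; exact: cube_coord_le. Qed.

Lemma lform_cube_eq w x : cube x ->
  (lform w x = lform_max w <-> cube_face (sign_cell w) x).
Proof.
move=> cx.
have -> : (lform w x = lform_max w) <->
    forall i, w i * x 0 i = Num.max (w i) 0.
  split=> [e i|e]; last by apply: eq_bigr.
  have : \sum_j (Num.max (w j) 0 - w j * x 0 j) = 0.
    by rewrite sumrB -/(lform_max w) -e subrr.
  move=> /psumr_eq0P h.
  by apply/eqP; rewrite eq_sym -subr_eq0 h // => j _; rewrite subr_ge0 cube_coord_le.
split=> [e|[_ e] i].
  split => // i b; rewrite ffunE; have := e i.
  case: (ltrgtP 0 (w i)) => // w0 ei [<-]; first by apply: (mulfI (lt0r_neq0 w0)); rewrite mulr1.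
  by move/eqP: ei; rewrite mulf_eq0 (lt_eqF w0) => /eqP.
have := e i; rewrite ffunE; case: (ltrgtP 0 (w i)) => w0.
- by move=> /(_ true erefl) ->; rewrite mulr1.
- by move=> /(_ false erefl) ->; rewrite mulr0.
- by rewrite -w0 mul0r.
Qed.

Lemma cube_model : cell_model (face (@cube R m)) cube_face.
Proof.
split; [|by move=> s; exists (cube_center s); exact: cube_center_in
  |exact: cube_face_sub].
apply/seteqP; split=> [F [u [c [uc ->]]]|F [->|[s _ <-]]].
- pose w i := u (delta_mx 0 i); have uE : u =1 lform w := lform_eq u.
  (* A vertex of the cube attaining [lform_max w]. A valid bound c is then either this maximum,
     giving the face [sign_cell w], or larger, giving the empty face. *)
  pose v := cube_center [ffun i => Some (0 < w i)].
  have [cv vE] := cube_center_in [ffun i => Some (0 < w i)].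
  have lv : lform w v = lform_max w.
    apply: eq_bigr => i _; rewrite (vE i (0 < w i)) ?ffunE //.
    by case: (ltP 0 (w i)) => w0; rewrite ?mulr1 ?mulr0.
  have := uc _ cv; rewrite uE lv le_eqVlt => /predU1P[cE|lt_c].
    right; exists (sign_cell w) => //.
    apply/seteqP; split => [x fx|x [cx]] /=.
      have [cx _] := fx; split => //=.
      by rewrite uE -cE; apply/lform_cube_eq.
    by rewrite uE -cE => /lform_cube_eq; apply.
  left; apply/seteqP; split => // x [cx /=]; rewrite uE => xc.
  by have := lform_cube_le w cx; rewrite xc leNgt lt_c.
- exact: face_set0.
- pose w i : R := if s i is Some b then (-1) ^+ (~~ b) else 0.
  have sE : s = sign_cell w.
    apply/ffunP => i; rewrite ffunE /w; case: (s i) => [[]|] /=.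
    + by rewrite expr0 ltr01.
    + by rewrite expr1 ltr0N1 ltrN10.
    + by rewrite ltxx.
  exists (lform w), (lform_max w); split=> [x|]; first exact: lform_cube_le.
  rewrite {1}sE; apply/seteqP; split => [x fx|x [cx]] /=.
    by have [cx _] := fx; split => //=; apply/lform_cube_eq.
  by move=> /lform_cube_eq; apply.
Qed.

End CubeFaces.

Lemma cell_model_dim (R : realType) (T : Type) (A : set (set T)) (I : finType)
    (phi : cell I -> set T) : cell_model A phi ->
  forall j, inclusion_iso A (face (@cube R j)) <-> j = #|I|.
Proof.
move=> mA j; split=> [iso|jI].
  have A0 : A set0 by case: mA => -> _ _; left.
  have [psi mA'] := inclusion_iso_model A0 iso cube_model.
  have := cell_model_leq_card mA' mA; have := cell_model_leq_card mA mA'.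
  by rewrite card_ord => le1 le2; apply/eqP; rewrite eqn_leq le1 le2.
have [psi mA'] : exists psi : cell 'I_j -> set T, cell_model A psi.
  by apply: cell_model_reindex mA; rewrite card_ord.
exact: cell_model_iso mA' cube_model.
Qed.

(** * Faces of the subdivision *)

Section IntervalCells.
Context {I : finType} (s : cell I).
Notation J := {i | s i != None}.

(* The intervals [[lo, hi]] of cells between [s] and the whole cube form a cube
   on the coordinates fixed by [s]: at such a coordinate, [Some false] keeps both
   ends equal to [s], [Some true] frees both, and [None] frees only [hi]. *)
Definition interval_lo (r : cell J) : cell I :=
  [ffun i => if insub i is Some j then
     if r j == Some true then None else s i else None].

Definition interval_hi (r : cell J) : cell I :=
  [ffun i => if insub i is Some j then
     if r j == Some false then s i else None else None].

Lemma interval_lo_hi r :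
  cell_le s (interval_lo r) /\ cell_le (interval_lo r) (interval_hi r).
Proof.
split=> i; rewrite !ffunE; case: insubP => [j sj _|_]; do ?by left.
  by case: eqP => _; [left|right].
by case: (r j) => [[]|]; [left|right|left].
Qed.

Lemma interval_le r r' :
  cell_le (interval_lo r') (interval_lo r) /\
  cell_le (interval_hi r) (interval_hi r') <-> cell_le r r'.
Proof.
split=> [[lo hi] j|le].
  have := lo (val j); have := hi (val j); rewrite !ffunE valK.
  move: (valP j) => /=; move: (r j) (r' j) (s (val j)) => x y z.
  by case: x y => [[]|] [[]|]; case: z => [b|] //= _ [h1|h1] [h2|h2]; (try by left); right.
split=> i; rewrite !ffunE; case: insubP => [j sj _|_]; do ?by left.
  have [->|->] := le j.
    by case: (r j) => [[]|]; (try by left); right.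
  by case: (r' j) => [[]|]; (try by left); right.
have [->|->] := le j.
  by case: (r j) => [[]|]; (try by left); right.
by case: (r' j) => [[]|]; (try by left); right.
Qed.

Lemma interval_surj a b : cell_le s a -> cell_le a b ->
  exists r, interval_lo r = a /\ interval_hi r = b.
Proof.
move=> sa ab.
(* Free already in [a], free only in [b], or fixed in both. *)
exists [ffun j : J => if a (val j) == None then Some true
                  else if b (val j) == None then None else Some false].
split; apply/ffunP => i; rewrite !ffunE; have := sa i; have := ab i;
  case: insubP => [j sj ji|]; rewrite ?ffunE ?ji ?negbK => //.
- by case: (a i) => [x|] //=; case: (b i) => [y|] //= _ [].
- by move=> /eqP -> _ [|<-].
- by case: (a i) => [x|] /=; case: (b i) => [y|] //= [] // <- [].
- by move=> /eqP -> [->|<-] // [->|<-].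
Qed.

End IntervalCells.
Arguments interval_lo {I} s r.
Arguments interval_hi {I} s r.
Arguments interval_lo_hi {I} s r.

Section Subdivision.
Context {R : realType} {n : nat} (K : set (set 'rV[R]_n)).
Hypothesis cK : cubical_complex K.

Definition lower (L : set (set 'rV[R]_n)) F := [set G | L G /\ G `<=` F].

Lemma face_model P : K P -> P !=set0 ->
  exists m, exists phi : cell 'I_m -> set 'rV[R]_n, cell_model (lower K P) phi.
Proof.
move=> KP P0; have [_ h Kf _] := cK; have [_ /(_ P0)[m iso]] := h _ KP.
have [_ _ iso'] : dim_face K m P by apply/(dim_faceE _ _ cK).
exists m; apply: inclusion_iso_model iso' cube_model; split; last exact: sub0set.
by apply: (Kf P) => //; exact: face_set0.
Qed.

Lemma sd_cell_sdc F G : K F -> K G -> F !=set0 -> F `<=` G -> sdc K (sd_cell K F G).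
Proof. by move=> KF KG F0 FG; right; exists F, G. Qed.

(** By [sd_cell_sub] the cells below this one come from the intervals inside [phi s, G]; these are
    the pairs s <= a <= b of cells, which [interval_lo] and [interval_hi] encode by cells on the
    coordinates fixed by [s]. *)
Lemma sd_model G (I : finType) (phi : cell I -> set 'rV[R]_n) (s : cell I) :
  K G -> cell_model (lower K G) phi ->
  cell_model (lower (sdc K) (sd_cell K (phi s) G))
    (fun r => sd_cell K (phi (interval_lo s r)) (phi (interval_hi s r))).
Proof.
move=> KG [lE n0 le].
have lphi t : K (phi t) /\ phi t `<=` G.
  by suff : lower K G (phi t) by []; rewrite lE; right; exists t.
have Kphi t : K (phi t) by have [] := lphi t.
have phiG t : phi t `<=` G by have [] := lphi t.
have lohi r : phi (interval_lo s r) `<=` phi (interval_hi s r).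
  by apply/le; have [] := interval_lo_hi s r.
split=> [|r|r r'].
- apply/seteqP; split=> [X [sX XQ]|X [->|[r _ <-]]].
  + case: sX => [->|[F' [G' [KF' KG' F'0 FG' XE]]]]; first by left.
    right; move: XQ; rewrite XE => /(sd_cell_sub cK)[] // sF' G'G.
    have phiE P : K P -> P !=set0 -> P `<=` G -> exists t, phi t = P.
      move=> KP P0 PG; have : lower K G P by [].
      by rewrite lE => -[e|[t _ <-]]; [move: P0; rewrite e => -[]|exists t].
    have [a aE] := phiE F' KF' F'0 (subset_trans FG' G'G).
    have [b bE] : exists t, phi t = G'.
      by apply: phiE => //; case: F'0 => x /FG'; exists x.
    have [||r [ra rb]] := @interval_surj _ s a b.
    * by apply/le; rewrite aE.
    * by apply/le; rewrite aE bE.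
    * by exists r => //; rewrite ra rb aE bE.
  + by split; [left|exact: sub0set].
  + split; first exact: sd_cell_sdc.
    apply/(sd_cell_sub cK) => //; split => //.
    by apply/le; have [] := interval_lo_hi s r.
- exact: sd_cell_neq0.
- rewrite sd_cell_sub // !le; exact: interval_le.
Qed.

End Subdivision.

(** * Short h-polynomials as sums over faces *)

Section Counting.
Context {R : realType} {n : nat}.
Implicit Types (L : set (set 'rV[R]_n)).

Definition faces L : seq (set 'rV[R]_n) := fset_set [set F | L F /\ F !=set0].

Lemma mem_faces L F : finite_set L ->
  reflect (L F /\ F !=set0) (F \in faces L).
Proof.
move=> Lfin; rewrite in_fset_set; last by apply: sub_finite_set Lfin => G [].
by apply: (iffP idP); rewrite inE.
Qed.

(** Regrouping by faces instead of dimensions allows reindexing along bijections of faces. *)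
Lemma fvec_sum L (dimL : set 'rV[R]_n -> nat) d (W : nat -> {poly rat}) :
  finite_set L ->
  (forall F, L F -> F !=set0 -> forall j, dim_face L j F <-> j = dimL F) ->
  (forall F, L F -> F !=set0 -> (dimL F < d)%N) ->
  \sum_(j < d) (fvec L j)%:R *: W j = \sum_(F <- faces L) W (dimL F).
Proof.
move=> Lfin LE Ld.
have fE j : fvec L j = count (fun F => dimL F == j) (faces L).
  rewrite /fvec -size_filter; apply: perm_size; apply: uniq_perm.
  - exact: fset_uniq.
  - by rewrite filter_uniq // fset_uniq.
  move=> F; rewrite mem_filter in_fset_set; last first.
    by apply: sub_finite_set Lfin => G [].
  apply/idP/andP; rewrite inE.
    move=> dF; have [LF F0 _] := dF; split; last exact/mem_faces.
    by have /LE -> := dF.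
  by move=> [/eqP <- /(mem_faces _ Lfin)[LF F0]]; apply/LE.
transitivity (\sum_(j < d) \sum_(F <- faces L | dimL F == j) W j).
  apply: eq_bigr => j _; rewrite fE big_const_seq iter_addr_0.
  by rewrite scaler_nat.
rewrite (exchange_big_dep xpredT) //= big_seq [RHS]big_seq; apply: eq_bigr => F.
move=> /(mem_faces _ Lfin)[LF F0].
by rewrite (big_pred1 (Ordinal (Ld _ LF F0))).
Qed.

End Counting.

(** The contribution of a j-dimensional face to the short h-polynomial. Here [d] is the dimension of
    the complex, one less than the [d] of [hsc_poly]. *)
Definition cell_weight (d j : nat) : {poly rat} := (2 *: 'X) ^+ j * (1 - 'X) ^+ (d - j).

(** The sum factors over coordinates: each of the two fixed values contributes [2 *: 'X] and the
    free one [1 - 'X], in total [1 + 3 * 'X]. *)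
Lemma sum_cell_weight m d : (m <= d)%N ->
  \sum_(s : cell 'I_m) cell_weight d #|{: {i | s i != None}}|
  = (1 + 3 * 'X) ^+ m * (1 - 'X) ^+ (d - m).
Proof.
move=> le_md; pose w (o : option bool) : {poly rat} := if o is Some _ then 2 *: 'X else 1 - 'X.
transitivity ((\prod_(i < m) \sum_(o : option bool) w o) * (1 - 'X) ^+ (d - m)).
  rewrite bigA_distr_bigA mulr_suml; apply: eq_bigr => s _.
  rewrite card_sig (bigID (fun i => s i != None)) /=.
  rewrite (eq_bigr (fun=> 2 *: 'X)); last by move=> i; case: (s i).
  rewrite [X in _ * X * _](eq_bigr (fun=> 1 - 'X)); last by move=> i; case: (s i).
  rewrite !prodr_const -mulrA -exprD /cell_weight; congr (_ ^+ _ * _ ^+ _).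
  have -> : #|(fun i => ~~ (s i != None))| = (m - #|[pred x | s x != None]|)%N.
    have /(congr1 (subn^~ #|[pred x | s x != None]|)) :=
      cardC [pred x | s x != None].
    by rewrite addKn card_ord.
  have aux c : (c <= m -> d - c = m - c + (d - m))%N by lia.
  by apply: aux; apply: leq_trans (max_card _) _; rewrite card_ord.
rewrite prodr_const card_ord; congr (_ ^+ _ * _).
rewrite (bigD1 None) //= (bigD1 (Some true)) //= (bigD1 (Some false)) //= big1.
  by rewrite scaler_nat; ring.
by case=> [[]|].
Qed.

Lemma hsc_poly_size (R : realType) n (K : set (set 'rV[R]_n)) m :
  (size (hsc_poly m.+1 K) <= m.+1)%N.
Proof.
apply: leq_trans (size_sum _ _ _) _; apply/bigmax_leqP => j _.
apply: leq_trans (size_scale_leq _ _) _.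
apply: leq_trans (size_polyMleq _ _) _.
have h1 : (size ((2 *: 'X : {poly rat}) ^+ j)%R <= j.+1)%N.
  apply: size_exp_linear; apply: leq_trans (size_scale_leq _ _) _.
  by rewrite size_polyX.
have h2 : (size ((1 - 'X : {poly rat}) ^+ (m - j))%R <= (m - j).+1)%N.
  by apply: size_exp_linear; rewrite -opprB size_polyN size_XsubC.
have aux a b : (a <= j.+1 -> b <= (m - j).+1 -> (a + b).-1 <= m.+1)%N.
  by have := ltn_ord j; lia.
exact: aux h1 h2.
Qed.

Lemma hc_hsc (R : realType) n (K : set (set 'rV[R]_n)) d i :
  (hsc_poly d K)`_i = hc d K i + hc d K i.+1.
Proof. by rewrite /= addrC subrK. Qed.

(** * The short h-polynomial of the subdivision *)

Section MainCount.
Context {R : realType} {n : nat} (K : set (set 'rV[R]_n)) (m : nat).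
Hypotheses (cK : cubical_complex K) (dK : has_dim K m).

Let Kfin : finite_set K. Proof. by case: cK. Qed.

Lemma face_dim_model : exists D : set 'rV[R]_n -> nat,
  forall G, K G -> G !=set0 -> (D G <= m)%N /\
    exists phi : cell 'I_(D G) -> set 'rV[R]_n, cell_model (lower K G) phi.
Proof.
have /choice[D DP] : forall G, exists k, K G -> G !=set0 -> (k <= m)%N /\
    exists phi : cell 'I_k -> set 'rV[R]_n, cell_model (lower K G) phi.
  (* Choice needs a value for every set; 0 serves outside the nonempty members of [K]. *)
  move=> G; have [[KG G0]|h] := pselect (K G /\ G !=set0); last first.
    by exists 0%N => KG G0; case: h.
  have [k [phi mphi]] := face_model cK KG G0.
  exists k => _ _; split; last by exists phi.
  have [_ dmax] := dK; apply: (dmax k G); split => //.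
  by apply/(cell_model_dim _ mphi); rewrite card_ord.
by exists D.
Qed.

(** The cells are grouped by the upper end [G] of their interval. The lower ends are then the cells
    [s] of a cube, and the dimension is the number of coordinates fixed by [s]. *)
Lemma hsc_poly_sdc : hsc_poly m.+1 (sdc K) = homogenize m (hsc_poly m.+1 K).
Proof.
have [D DP] := face_dim_model.
have D_le G : K G -> G !=set0 -> (D G <= m)%N by move=> KG G0; have [] := DP G KG G0.
have KE : hsc_poly m.+1 K = \sum_(G <- faces K) cell_weight m (D G).
  apply: (fvec_sum (cell_weight m) Kfin) => F KF F0; last by rewrite ltnS D_le.
  move=> j; have [_ [phi mphi]] := DP F KF F0.
  rewrite -(card_ord (D F)) -(cell_model_dim R mphi).
  by split=> [[]//|]; split.
pose N := faces K; pose sub G := [seq F <- N | `[< F `<=` G >]].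
pose Ns := [seq sd_cell K F G | G <- N, F <- sub G].
have NP F : reflect (K F /\ F !=set0) (F \in N) by exact: mem_faces.
have subP G F : reflect [/\ K F, F !=set0 & F `<=` G] (F \in sub G).
  rewrite mem_filter; apply: (iffP andP) => [[/asboolP FG /NP[]]|[KF F0 FG]] //.
  by split; [apply/asboolP|apply/NP].
have sdcP Q : sdc K Q /\ Q !=set0 <-> Q \in Ns.
  split=> [[[->|[F [G [KF KG F0 FG ->]]]] Q0]|].
  - by case: Q0.
  - apply/allpairsPdep; exists G, F; split => //; last exact/subP.
    by apply/NP; split => //; case: F0 => x /FG; exists x.
  - move=> /allpairsPdep[G [F [/NP[KG G0] /subP[KF F0 FG] ->]]].
    by split; [exact: sd_cell_sdc|exact: sd_cell_neq0].
have sfin : finite_set (sdc K).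
  apply: (@sub_finite_set _ _ [set` set0 :: Ns]); last exact: finite_seq.
  move=> Q sQ /=; rewrite inE; have [//|Q0] := eqVneq Q set0.
  by apply/sdcP; split => //; apply/set0P.
(* Each nonempty cell occurs once in [Ns], since it determines both ends of its interval. *)
have Ns_perm : perm_eq (faces (sdc K)) Ns.
  apply: uniq_perm; first exact: fset_uniq.
    apply: allpairs_uniq_dep; first exact: fset_uniq.
      by move=> G _; rewrite filter_uniq // fset_uniq.
    move=> p q /allpairsPdep[G [F [/NP[KG G0] /subP[KF F0 FG] ->]]].
    move=> /allpairsPdep[G' [F' [/NP[KG' G'0] /subP[KF' F'0 FG'] ->]]] /= e.
    have [FF GG] : F' `<=` F /\ G `<=` G' by apply/(sd_cell_sub cK) => //; rewrite e.
    have [FF' GG'] : F `<=` F' /\ G' `<=` G by apply/(sd_cell_sub cK) => //; rewrite e.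
    by have -> : G = G' by [apply/seteqP]; have -> : F = F' by apply/seteqP.
  by move=> Q; apply/idP/idP => [/(mem_faces _ sfin)/sdcP|/sdcP/(mem_faces _ sfin)].
have model G : G \in N -> exists phi : cell 'I_(D G) -> set 'rV[R]_n, cell_model (lower K G) phi.
  by move=> /NP[KG G0]; have [] := DP G KG G0.
have sdim G (phi : cell 'I_(D G) -> set 'rV[R]_n) s : G \in N -> cell_model (lower K G) phi ->
    forall j, dim_face (sdc K) j (sd_cell K (phi s) G) <->
      j = #|{: {i | s i != None}}|.
  move=> /NP[KG G0] mphi j.
  have [lE n0 _] := mphi.
  have [Kp pG] : lower K G (phi s) by rewrite lE; right; exists s.
  rewrite -(cell_model_dim R (sd_model cK s KG mphi)).
  by split=> [[]//|]; split => //; [exact: sd_cell_sdc|exact: sd_cell_neq0].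
have sub_perm G (phi : cell 'I_(D G) -> set 'rV[R]_n) : G \in N -> cell_model (lower K G) phi ->
    perm_eq (sub G) [seq phi s | s <- enum {: cell 'I_(D G)}].
  move=> /NP[KG G0] mphi; have [lE n0 _] := mphi.
  apply: uniq_perm; first by rewrite filter_uniq // fset_uniq.
    by rewrite map_inj_uniq ?enum_uniq //; exact: cell_model_inj mphi.
  move=> F; apply/subP/mapP => [[KF F0 FG]|[s _ ->]].
    have : lower K G F by [].
    rewrite lE => -[e|[s _ <-]]; first by move: F0; rewrite e => -[].
    by exists s => //; rewrite mem_enum.
  have [Kp pG] : lower K G (phi s) by rewrite lE; right; exists s.
  by split.
have /choice[D' D'P] : forall Q, exists k, sdc K Q -> Q !=set0 ->
    (k <= m)%N /\ forall j, dim_face (sdc K) j Q <-> j = k.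
  move=> Q; have [QN|QN] := boolP (Q \in Ns); last first.
    by exists 0%N => sQ Q0; case/negP: QN; apply/sdcP.
  have /allpairsPdep[G [F [GN FG ->]]] := QN.
  have [phi mphi] := model G GN.
  move: FG; rewrite (perm_mem (sub_perm G phi GN mphi)) => /mapP[s _ ->].
  exists #|{: {i | s i != None}}| => _ _; split; last exact: sdim.
  have /NP[KG G0] := GN; apply: leq_trans (D_le _ KG G0).
  by rewrite card_sig -[leqRHS]card_ord max_card.
have SE : hsc_poly m.+1 (sdc K) = \sum_(Q <- faces (sdc K)) cell_weight m (D' Q).
  by apply: (fvec_sum (cell_weight m) sfin) => F sF F0; have [] := D'P F sF F0.
rewrite SE (perm_big _ Ns_perm) big_allpairs_dep KE linear_sum /=.
rewrite big_seq [RHS]big_seq; apply: eq_bigr => G GN.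
have [phi mphi] := model G GN; have /NP[KG G0] := GN.
(* For fixed [G], the homogenized weight of [G] equals the sum of the weights of all cells with
   upper end [G]. *)
rewrite /cell_weight homogenize_cell ?D_le // -sum_cell_weight ?D_le //.
rewrite (perm_big _ (sub_perm G phi GN mphi)) big_map -big_enum.
apply: eq_bigr => s _; congr (cell_weight _ _).
have [lE n0 _] := mphi.
have [Kp pG] : lower K G (phi s) by rewrite lE; right; exists s.
have [_ h] := D'P _ (sd_cell_sdc Kp KG (n0 s) pG) (sd_cell_neq0 cK Kp KG (n0 s) pG).
by apply/(sdim G phi s GN mphi)/h.
Qed.

End MainCount.

Theorem theorem4p1 (d : nat) (d_gt0 : (0 < d)%N) :
  exists C : 'M[rat]_d.+1,
    [/\ has_genfun C,
        forall C' : 'M[rat]_d.+1, has_genfun C' -> C' = C,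
        forall i j : 'I_d.+1, 0 <= C i j
      & forall (R : realType) (n : nat) (K : set (set 'rV[R]_n)),
          cubical_complex K -> has_dim K d.-1 ->
          forall i : 'I_d.+1,
            hc d (sdc K) i = \sum_(j < d.+1) C i j * hc d K j].
Proof.
(* With d = m + 1, the dimension of the complex is m. *)
case: d d_gt0 => // m _; exists (Cmatrix m); split.
- exact: Cmatrix_genfun.
- by move=> C' ?; apply: has_genfun_uniq => //; exact: Cmatrix_genfun.
- by move=> i j; rewrite mxE column_ge0.
move=> R n K cK dK i.
rewrite (@long_transform m (hc m.+1 K) (hc m.+1 (sdc K)) (hsc_poly m.+1 K)
  (hsc_poly m.+1 (sdc K))).
- by apply: eq_bigr => j _; rewrite mxE.
- exact: hsc_poly_size.
- exact: hsc_poly_size.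
- by move=> k _; exact: hc_hsc.
- by move=> k _; exact: hc_hsc.
(* Both long h-vectors start with 2^m. *)
- by [].
- exact: hsc_poly_sdc.
- by rewrite -ltnS.
Qed.
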